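(* For every integer $r\ge2$, every $\varepsilon\in(0,1)$ and every $K\ge1$ there exist constants $c,C>0$ depending only on $r,K,\varepsilon$ such that the following holds. Let $n_1,\dots,n_r\ge2$ be integers and let $T\in\mathbb R^{n_1\times\cdots\times n_r}$ be a random tensor whose entries are i.i.d. copies of a mean-zero random variable $Z$ with $\sigma^2:=\mathbb E Z^2<\infty$ and $\mathbb E|Z|^{2+\varepsilon}\le K\sigma^{2+\varepsilon}$. Let $n:=\max(n_1,\dots,n_r)$ and $$R:=\max_{k\in[r]}\ \mathbb E\left[\max_{\substack{i_j\in[n_j]\\ j\in[r]\setminus\{k\}}}\Big(\sum_{i_k=1}^{n_k}T_{i_1,\dots,i_r}^2\Big)^{1/2}\right].$$ Then $$c\,\big(\sigma\sqrt n+\mathbb E\|T\|_\infty\big)\le R\le C\,\big(\sigma\sqrt n+\mathbb E\|T\|_\infty\big).$$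
   Context: $[m]=\{1,\dots,m\}$. $\|T\|_\infty$ is the maximum absolute value of the entries of $T$. *)

(* Defs.v *)
From HB Require Import structures.
Set Warnings "-notation-incompatible-prefix,-notation-overridden".
From mathcomp Require Export all_boot all_order all_algebra.
From mathcomp Require Export all_classical all_reals all_analysis.

Set Implicit Arguments.
Unset Strict Implicit.
Unset Printing Implicit Defensive.

Import Order.TTheory GRing.Theory Num.Theory.

Local Open Scope classical_set_scope.
Local Open Scope ring_scope.

Definition tindex (r : nat) (n : 'I_r -> nat) : finType :=
  {dffun forall j : 'I_r, 'I_(n j)}.

Definition set_coord (r : nat) (n : 'I_r -> nat) (i : tindex n)
    (k : 'I_r) (l : 'I_(n k)) : tindex n :=
  finfun (dfwith (fun j => i j) k l).

Definition mutually_independent (R : realType) (d : measure_display)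
    (Omega : measurableType d) (P : probability Omega R)
    (I : finType) (X : I -> {RV P >-> R}) : Prop :=
  forall (J : {set I}) (B : I -> set R), (forall i, measurable (B i)) ->
    P (\bigcap_(i in [set` J]) (X i @^-1` B i))
    = (\prod_(i in J) P (X i @^-1` B i))%E.

(* The two distributions are compared on Borel sets only: a probability is
   unconstrained outside the sigma-algebra. *)
Definition same_distribution (R : realType)
    (d : measure_display) (Omega : measurableType d) (P : probability Omega R)
    (d' : measure_display) (Omega' : measurableType d')
    (P' : probability Omega' R)
    (X : {RV P >-> R}) (Y : {RV P' >-> R}) : Prop :=
  forall B : set R, measurable B -> distribution P X B = distribution P' Y B.

Definition iid_copies (R : realType)
    (d : measure_display) (Omega : measurableType d) (P : probability Omega R)
    (d' : measure_display) (Omega' : measurableType d')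
    (P' : probability Omega' R)
    (I : finType) (X : I -> {RV P >-> R}) (Z : {RV P' >-> R}) : Prop :=
  mutually_independent X /\ forall i, same_distribution (X i) Z.

Definition tensor_norm_infty (R : realType) (r : nat) (n : 'I_r -> nat)
    (t : tindex n -> R) : R :=
  \big[Num.max/0]_(i : tindex n) `|t i|.

(* The maximum over (i_j)_{j != k} is taken over full multi-indices i: the
   summand overwrites the k-th coordinate, so i_k plays no role (and every
   coordinate range is nonempty in the intended use). The default value 0 of
   the maximum is harmless since all terms are nonnegative. *)
Definition max_fiber_norm (R : realType) (r : nat) (n : 'I_r -> nat)
    (t : tindex n -> R) (k : 'I_r) : R :=
  \big[Num.max/0]_(i : tindex n)
    Num.sqrt (\sum_(l < n k) t (set_coord i l) ^+ 2).

Definition tensor_R (R : realType) (d : measure_display)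
    (Omega : measurableType d) (P : probability Omega R)
    (r : nat) (n : 'I_r -> nat) (T : tindex n -> {RV P >-> R}) : \bar R :=
  \big[maxe/-oo%E]_(k < r)
    'E_P[fun w => max_fiber_norm (fun i => T i w) k]%E.

(* Main.v *)
Require Import Defs.
From mathcomp Require Import measurable_realfun ring lra.
Set Implicit Arguments.
Unset Strict Implicit.
Unset Printing Implicit Defensive.
Import Order.TTheory GRing.Theory Num.Theory.
Import HBNNSimple.
Local Open Scope classical_set_scope.
Local Open Scope ring_scope.

(* Lower bound: every fiber norm dominates each of its entries, and by
   Cauchy-Schwarz it dominates n_k^(-1/2) times the sum of their absolute
   values, while E|Z| >= c sigma follows from the (2+eps)-th moment through
   z^2 <= M |z| + M^(-eps) |z|^(2+eps).

   Upper bound: split the squared entries of a fiber at |z| = s n^(1/4), with s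
   slightly above sigma.  The part below is controlled by the exponential
   moment bound  exp(S / 2b) <= prod (1 + y / b).  For the part above, if the
   sum S exceeds q ||T||_oo^2 then every term is at most S / q, and concavity of
   the logarithm gives  prod (1 + th y) >= (1 + th S / q)^q.  Its terms have
   mean at most K s^2 n^(-eps/4), so th can be taken to be n^(eps/4) / (s^2 n)
   while the product keeps a bounded expectation; for q >= 4r/eps the right-hand
   side then beats the union bound over the at most n^r fibers. *)

(** * Expectation of a product over independent variables *)

Section product_of_independent.
Context {R : realType} {d : measure_display} {T : measurableType d}.
Variable P : probability T R.

(** By linearity: a simple function is a finite combination of indicators of its level sets, and the
    hypothesis on [H] handles each of them. *)
Lemma integral_mul_comp_nnsfun (X : {RV P >-> R}) (H : T -> R) (c : R) :
  measurable_fun setT H -> (forall w, 0 <= H w) -> 0 <= c ->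
  (forall B : set R, measurable B ->
    (\int[P]_w (H w * \1_B (X w))%:E = c%:E * P (X @^-1` B))%E) ->
  forall phi : {nnsfun R >-> R},
    (\int[P]_w (H w * phi (X w))%:E = c%:E * \int[P]_w (phi (X w))%:E)%E.
Proof.
move=> mH H0 c0 HB phi.
have mXB (B : set R) : measurable B -> measurable (X @^-1` B).
  by move=> mB; rewrite -[X in measurable X]setTI; exact: measurable_funP.
set s := finmap.enum_fset (fset_set (range phi)).
have s_ge0 (i : 'I_(size s)) : 0 <= s`_i.
  have : s`_i \in s by rewrite mem_nth.
  by rewrite in_fset_set // inE => -[x _ <-].
have mphi (i : 'I_(size s)) : measurable (phi @^-1` [set s`_i]) by [].
have m1 (i : 'I_(size s)) :
    measurable_fun setT (fun w => \1_(phi @^-1` [set s`_i]) (X w) : R).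
  by apply: measurableT_comp => //; exact: measurable_indic.
have -> : (\int[P]_w (H w * phi (X w))%:E =
    \sum_(i < size s)
      (s`_i)%:E * (c%:E * P (X @^-1` (phi @^-1` [set s`_i]))))%E.
  pose F (i : 'I_(size s)) w : R := H w * \1_(phi @^-1` [set s`_i]) (X w).
  transitivity (\int[P]_w (\sum_(i < size s) ((s`_i)%:E * (F i w)%:E)))%E.
    apply: eq_integral => w _; rewrite fimfunEord -/s mulr_sumr -sumEFin.
    by apply: eq_bigr => i _; rewrite mulrCA.
  have mF i : measurable_fun setT (EFin \o F i).
    by apply/measurable_EFinP; exact: measurable_funM.
  have F0 i w : 0 <= F i w by rewrite mulr_ge0.
  rewrite ge0_integral_sum //; first last.
  - by move=> i w _; rewrite mule_ge0 // lee_fin.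
  - by move=> i; apply: (measurable_funeM (s`_i)%:E (mF i)).
  apply: eq_bigr => i _; rewrite ge0_integralZl_EFin //; first by rewrite HB.
    by move=> w _; rewrite lee_fin.
  exact: mF.
have -> : (\int[P]_w (phi (X w))%:E =
    \sum_(i < size s) (s`_i)%:E * P (X @^-1` (phi @^-1` [set s`_i])))%E.
  transitivity (\int[P]_w (\sum_(i < size s)
      ((s`_i)%:E * (\1_(phi @^-1` [set s`_i]) (X w))%:E)))%E.
    apply: eq_integral => w _; by rewrite fimfunEord -/s -sumEFin.
  rewrite ge0_integral_sum //; first last.
  - by move=> i w _; rewrite mule_ge0 // lee_fin.
  - by move=> i; apply: measurable_funeM; apply/measurable_EFinP; exact: m1.
  apply: eq_bigr => i _; rewrite ge0_integralZl_EFin //; last first.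
    exact/measurable_EFinP.
  congr (_ * _)%E; under eq_integral do rewrite -[\1__ _]/(\1_(X @^-1` _) _).
  by rewrite integral_indic ?setIT //; exact: mXB.
rewrite ge0_sume_distrr; last by move=> i _; rewrite mule_ge0 // lee_fin.
by apply: eq_bigr => i _; rewrite muleCA.
Qed.

(** Monotone convergence along simple functions increasing to [g]. In the product formula, [H] is
    the product of the other factors and [c] its mean. *)
Lemma integral_mul_comp (X : {RV P >-> R}) (H : T -> R) (c : R)
    (g : R -> R) :
  measurable_fun setT H -> (forall w, 0 <= H w) -> 0 <= c ->
  (forall B : set R, measurable B ->
    (\int[P]_w (H w * \1_B (X w))%:E = c%:E * P (X @^-1` B))%E) ->
  measurable_fun setT g -> (forall x, 0 <= g x) ->
  (\int[P]_w (H w * g (X w))%:E = c%:E * \int[P]_w (g (X w))%:E)%E.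
Proof.
move=> mH H0 c0 HB mg g0.
have mg' : measurable_fun setT (EFin \o g) by exact/measurable_EFinP.
pose phi n := nnsfun_approx measurableT mg' n.
have phi_cvg x : (phi n x)%:E @[n --> \oo] --> (g x)%:E.
  by apply: (cvg_nnsfun_approx measurableT mg') => // y _; rewrite lee_fin.
have phi_nd x : {homo (fun n => phi n x) : n m / (n <= m)%N >-> n <= m}.
  by move=> a b ab; have /lefP := nd_nnsfun_approx measurableT mg' ab; exact.
have mphiX n : measurable_fun setT (fun w => phi n (X w)).
  by apply: measurableT_comp.
have cvgH : (\int[P]_w (H w * phi n (X w))%:E @[n --> \oo] -->
             \int[P]_w (H w * g (X w))%:E)%E.
  have -> : (\int[P]_w (H w * g (X w))%:E =
      \int[P]_w limn (fun n => (H w * phi n (X w))%:E))%E.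
    apply: eq_integral => w _; apply/esym/cvg_lim => //.
    under eq_fun do rewrite EFinM; rewrite EFinM.
    exact: cvgeZl.
  apply: cvg_monotone_convergence => //.
  - by move=> n; apply/measurable_EFinP; exact: measurable_funM.
  - by move=> n w _; rewrite lee_fin mulr_ge0.
  - by move=> w _ a b ab; rewrite lee_fin ler_wpM2l // phi_nd.
have cvg1 : (\int[P]_w (phi n (X w))%:E @[n --> \oo] -->
             \int[P]_w (g (X w))%:E)%E.
  have -> : (\int[P]_w (g (X w))%:E =
      \int[P]_w limn (fun n => (phi n (X w))%:E))%E.
    by apply: eq_integral => w _; apply/esym/cvg_lim.
  apply: cvg_monotone_convergence => //.
  - by move=> n; exact/measurable_EFinP.
  - by move=> n w _; rewrite lee_fin.
  - by move=> w _ a b ab; rewrite lee_fin phi_nd.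
have eqH : (fun n => \int[P]_w (H w * phi n (X w))%:E)%E =
           (fun n => c%:E * \int[P]_w (phi n (X w))%:E)%E.
  by apply/funext => n; exact: (integral_mul_comp_nnsfun mH H0 c0 HB).
rewrite eqH in cvgH; apply: (cvg_unique _ cvgH) => //.
exact: cvgeZl.
Qed.

(* Indicators are replaced by general functions one index at a time. *)
Lemma integral_prod_indep (I : finType) (X : I -> {RV P >-> R})
    (g : I -> R -> R) (m : I -> R) :
  mutually_independent X ->
  (forall i, measurable_fun setT (g i)) -> (forall i x, 0 <= g i x) ->
  (forall i, (\int[P]_w (g i (X i w))%:E = (m i)%:E)%E) ->
  (\int[P]_w (\prod_i g i (X i w))%:E = (\prod_i m i)%:E)%E.
Proof.
move=> indep mg g0 gm.
(* The list [s] holds the indices whose function is arbitrary; off [s] all functions are indicators,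
   so the empty list is independence itself. *)
suff prod_indic (s : seq I) : forall (h : I -> R -> R) (p : I -> R),
    (forall i, measurable_fun setT (h i)) -> (forall i x, 0 <= h i x) ->
    (forall i, (\int[P]_w (h i (X i w))%:E = (p i)%:E)%E) ->
    (forall i, i \notin s -> exists2 B, measurable B & h i = \1_B) ->
    (\int[P]_w (\prod_i h i (X i w))%:E = (\prod_i p i)%:E)%E.
  by apply: (prod_indic (enum I)) => // i; rewrite mem_enum.
have mXB (B : set R) i : measurable B -> measurable (X i @^-1` B).
  by move=> mB; rewrite -[X in measurable X]setTI; exact: measurable_funP.
elim: s => [h p mh h0 hp hB|j s IH h p mh h0 hp hB].
  have /choice[B BP] : forall i, exists B, measurable B /\ h i = \1_B.
    by move=> i; have [//|B ? ?] := hB i; exists B.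
  have pE i : P (X i @^-1` B i) = (p i)%:E.
    rewrite -hp (BP i).2.
    under eq_integral do rewrite -[\1__ _]/(\1_(X i @^-1` _) _).
    by rewrite integral_indic ?setIT //; apply: mXB; exact: (BP i).1.
  have := indep finset.setT B (fun i => (BP i).1).
  rewrite (eq_bigr (fun i => (p i)%:E)); last by move=> i _; rewrite pE.
  rewrite (eq_bigl xpredT); last by move=> i; rewrite finset.in_setT.
  rewrite prodEFin => <-.
  have mcap : measurable
      (\bigcap_(i in [set` (finset.setT : {set I})]) (X i @^-1` B i)).
    apply: fin_bigcap_measurable => // i _; apply: mXB; exact: (BP i).1.
  rewrite -[X in P X]setIT -integral_indic //; apply: eq_integral => w _.
  congr (_%:E); rewrite indicE; case: (boolP (w \in _)) => [/set_mem wB|wB].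
  - rewrite big1 // => i _; rewrite (BP i).2 indicE mem_set //.
    by apply: wB; rewrite /= finset.in_setT.
  - have [i wBi] : exists i, ~ B i (X i w).
      apply/existsNP => wBi; move/negP: wB; apply; apply/mem_set => i _.
      exact: wBi.
    by rewrite (bigD1 i) //= (BP i).2 indicE memNset // mul0r.
pose H w := \prod_(i | i != j) h i (X i w).
pose c := \prod_(i | i != j) p i.
have p0 i : 0 <= p i.
  by rewrite -lee_fin -hp integral_ge0 // => w _; rewrite lee_fin.
have mH : measurable_fun setT H.
  rewrite /H; under eq_fun do rewrite -big_filter.
  apply: measurable_prod => i _; apply: measurableT_comp => //.
under eq_integral do rewrite (bigD1 j) //= mulrC -/(H _).
rewrite (bigD1 j) //= mulrC EFinM -hp -/c.
apply: integral_mul_comp => //.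
- by move=> w; apply: prodr_ge0 => i _.
- by apply: prodr_ge0 => i _.
move=> B mB.
(* Once the [j]-th function is an indicator, the induction hypothesis for [s] applies; it yields the
   factorization that [integral_mul_comp] asks for. *)
pose h' i := if i == j then \1_B else h i.
pose p' i := if i == j then fine (P (X j @^-1` B)) else p i.
have p'E : \prod_i p' i = c * fine (P (X j @^-1` B)).
  rewrite (bigD1 j) //= {1}/p' eqxx mulrC; congr (_ * _).
  by apply: eq_bigr => i ij; rewrite /p' (negbTE ij).
have PB : (fine (P (X j @^-1` B)))%:E = P (X j @^-1` B).
  by rewrite fineK // fin_num_measure //; exact: mXB.
rewrite -PB -EFinM -p'E -(IH h' p').
- apply: eq_integral => w _; congr (_%:E); rewrite [RHS](bigD1 j) //= mulrC.
  rewrite /h' eqxx; congr (_ * _); apply: eq_bigr => i ij.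
  by rewrite (negbTE ij).
- move=> i; rewrite /h'; case: ifP => // _; exact: measurable_indic.
- by move=> i x; rewrite /h'; case: ifP.
- move=> i; rewrite /h' /p'; case: eqP => [->|_]; last exact: hp.
  rewrite PB; under eq_integral do rewrite -[\1__ _]/(\1_(X j @^-1` _) _).
  by rewrite integral_indic ?setIT //; exact: mXB.
- move=> i is'; rewrite /h'; case: (eqVneq i j) => [_|ij]; first by exists B.
  by apply: hB; rewrite inE negb_or ij.
Qed.

End product_of_independent.

(** * Deterministic inequalities for sums along a fiber *)

Section real_inequalities.
Context {R : realType}.
Implicit Types (x y z M th eps A a b : R).

Lemma sqr_le_powR z M eps : 0 < M -> M <= `|z| -> 0 <= eps ->
  z ^+ 2 <= M `^ (- eps) * `|z| `^ (2 + eps).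
Proof.
move=> M0 Mz eps0; have z0 : 0 < `|z| by exact: lt_le_trans Mz.
rewrite powRD; last by rewrite (gt_eqF z0) implybT.
rewrite -[2]/(2%:R) powR_mulrn // real_normK ?num_real // mulrCA.
rewrite ler_peMr ?sqr_ge0 // powRN ler_pdivlMl ?powR_gt0 // mulr1.
by apply: ge0_ler_powR => //; rewrite nnegrE ltW.
Qed.

(** Cauchy-Schwarz against a constant vector, obtained by expanding the nonnegative sum of squared
    deviations of [|x l|] from their mean. *)
Lemma sum_norm_le_sqrt (m : nat) (x : 'I_m -> R) : (0 < m)%N ->
  (\sum_l `|x l|) / Num.sqrt m%:R <= Num.sqrt (\sum_l x l ^+ 2).
Proof.
move=> m0; set u := \sum_l `|x l|; set v := \sum_l x l ^+ 2.
have m0' : 0 < m%:R :> R by rewrite ltr0n.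
have u0 : 0 <= u by apply: sumr_ge0 => l _.
have v0 : 0 <= v by apply: sumr_ge0 => l _; exact: sqr_ge0.
suff uv : u ^+ 2 <= m%:R * v.
  rewrite ler_pdivrMr ?sqrtr_gt0 // mulrC -sqrtrM ?ler0n //.
  by rewrite -(ger0_norm u0) -sqrtr_sqr ler_sqrt // mulr_ge0 // ltW.
have : 0 <= \sum_l (`|x l| - u / m%:R) ^+ 2.
  by apply: sumr_ge0 => l _; exact: sqr_ge0.
have -> : \sum_l (`|x l| - u / m%:R) ^+ 2 = v - u ^+ 2 / m%:R.
  under eq_bigr do rewrite sqrrB real_normK ?num_real //.
  rewrite big_split sumrB /= -/v sumrMnl -mulr_suml -/u sumr_const card_ord.
  by rewrite -[_ *+ m]mulr_natr; field; rewrite gt_eqF.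
by rewrite subr_ge0 ler_pdivrMr // mulrC.
Qed.

(** From [expR (- (y / 2)) >= 1 - y / 2] and [(1 + y) * (1 - y / 2) >= 1] on the unit interval. *)
Lemma expR_half_le y : 0 <= y <= 1 -> expR (y / 2) <= 1 + y.
Proof.
move=> /andP[y0 y1]; have := expR_ge1Dx (- (y / 2)); rewrite expRN => h.
have e0 := expR_gt0 (y / 2).
have : (1 - y / 2) * expR (y / 2) <= 1 by rewrite -ler_pdivlMr // mul1r.
nra.
Qed.

(* Concavity of the logarithm between 1 and 1 + th M. *)
Lemma expR_ln_le th y M : 0 <= th -> 0 <= y <= M -> 0 < M ->
  expR (ln (1 + th * M) * (y / M)) <= 1 + th * y.
Proof.
move=> th0 /andP[y0 yM] M0.
have t01 : 0 <= y / M <= 1.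
  by rewrite divr_ge0 ?(ltW M0) //= ler_pdivrMr // mul1r.
have thM : 0 < 1 + th * M by rewrite ltr_pwDl // mulr_ge0 // ltW.
have thy : 0 < 1 + th * y by rewrite ltr_pwDl // mulr_ge0.
rewrite -[leRHS]lnK ?posrE // ler_expR.
have /andP[t0 t1] := t01.
have := @concave_ln R (Itv01 t0 t1) (1 + th * M) 1 thM ltr01.
rewrite !convRE /= ln1 mulr0 addr0 => h.
have -> : 1 + th * y = y / M * (1 + th * M) + (1 - y / M) * 1.
  by field; rewrite gt_eqF.
by rewrite mulrC.
Qed.

(** With [M] the sum divided by [q], concavity bounds each factor below by [1 + th * M] to the power
    [y l / M], and these exponents add up to [q]. *)
Lemma prod_ge_pow (m q : nat) (y : 'I_m -> R) th :
  (0 < q)%N -> 0 <= th -> 0 < \sum_l y l ->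
  (forall l, 0 <= y l <= (\sum_l y l) / q%:R) ->
  (1 + th * ((\sum_l y l) / q%:R)) ^+ q <= \prod_l (1 + th * y l).
Proof.
move=> q0 th0; set S := \sum_l _ => S0 yS.
have q0' : 0 < q%:R :> R by rewrite ltr0n.
have M0 : 0 < S / q%:R by rewrite divr_gt0.
set M := S / q%:R in M0 yS *.
have thM : 0 < 1 + th * M by rewrite ltr_pwDl // mulr_ge0 // ltW.
apply: le_trans (_ : \prod_l expR (ln (1 + th * M) * (y l / M)) <= _);
  last first.
  by apply: ler_prod => l _; rewrite expR_ge0 /= expR_ln_le.
rewrite -expR_sum -mulr_sumr -mulr_suml -/S.
have -> : S / M = q%:R by rewrite /M; field; rewrite !gt_eqF.
by rewrite [ln _ * _]mulrC expRM_natl lnK.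
Qed.

(** For the sum [S], first [sqrt S <= sqrt A + S / sqrt A]. Then [x <= a + expR (x - a)] at
    [x = S / (2b)] linearizes the exponential, which the product dominates. The free parameter [a]
    later makes [expR (- a)] absorb the number of fibers. *)
Lemma sqrt_sum_small_le (m : nat) (y : 'I_m -> R) b A a :
  0 < b -> 0 < A -> (forall l, 0 <= y l <= b) ->
  Num.sqrt (\sum_l y l) <= Num.sqrt A +
    2 * b / Num.sqrt A * (a + expR (- a) * \prod_l (1 + y l / b)).
Proof.
move=> b0 A0 yb; set S := \sum_l _.
have S0 : 0 <= S by apply: sumr_ge0 => l _; have /andP[] := yb l.
have sA : 0 < Num.sqrt A by rewrite sqrtr_gt0.
have SA : Num.sqrt S <= Num.sqrt A + S / Num.sqrt A.
  have := sqr_sqrtr S0; have := sqrtr_ge0 S; set u := Num.sqrt S => u0 <-.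
  rewrite -subr_ge0.
  have -> : Num.sqrt A + u ^+ 2 / Num.sqrt A - u =
    ((Num.sqrt A - u / 2) ^+ 2 + 3 / 4 * u ^+ 2) / Num.sqrt A.
    by field; rewrite gt_eqF.
  apply: divr_ge0; last exact: ltW.
  by apply: addr_ge0; [exact: sqr_ge0|rewrite mulr_ge0 ?sqr_ge0].
apply: (le_trans SA); rewrite lerD2l.
rewrite [leRHS]mulrAC ler_pM2r ?invr_gt0 //.
have pE : expR (S / b / 2) <= \prod_l (1 + y l / b).
  rewrite /S !mulr_suml expR_sum.
  apply: ler_prod => l _; rewrite expR_ge0 expR_half_le //.
  have /andP[? ?] := yb l.
  by rewrite divr_ge0 ?(ltW b0) //= ler_pdivrMr // mul1r.
have -> : S = b * 2 * (S / b / 2) by field; rewrite gt_eqF.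
rewrite [2 * b]mulrC ler_pM2l ?mulr_gt0 //.
have := expR_ge1Dx (S / b / 2 - a); rewrite expRD [expR _ * _]mulrC => h.
have : expR (- a) * expR (S / b / 2) <= expR (- a) * \prod_l (1 + y l / b).
  by rewrite ler_pM2l // expR_gt0.
move: h; set p := _ * \prod_l _; set e := expR (- a) * _; lra.
Qed.

(** The three summands answer three cases for the sum [S]: at most [q * M ^+ 2], at most [A], or
    above both. In the last case no term exceeds [S / q], so the product is at least
    [(th * S / q) ^+ q], hence at least [D / q ^+ q] times [(S / A) ^+ q]. *)
Lemma sqrt_sum_big_le (m q : nat) (y : 'I_m -> R) th M A D :
  (0 < q)%N -> 0 <= th -> 0 < A -> 0 < D -> D <= (th * A) ^+ q -> 0 <= M ->
  (forall l, 0 <= y l <= M ^+ 2) ->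
  Num.sqrt (\sum_l y l) <= Num.sqrt q%:R * M + Num.sqrt A +
    Num.sqrt A * (q%:R ^+ q / D * \prod_l (1 + th * y l)).
Proof.
move=> q0 th0 A0 D0 DA M0 yM; set S := \sum_l _.
have q0' : 0 < q%:R :> R by rewrite ltr0n.
have S0 : 0 <= S by apply: sumr_ge0 => l _; have /andP[] := yM l.
have prod0 : 0 <= \prod_l (1 + th * y l).
  apply: prodr_ge0 => l _; rewrite addr_ge0 // mulr_ge0 //.
  by have /andP[] := yM l.
have last0 : 0 <= Num.sqrt A * (q%:R ^+ q / D * \prod_l (1 + th * y l)).
  apply: mulr_ge0; first exact: sqrtr_ge0.
  by apply: mulr_ge0 => //; rewrite divr_ge0 ?exprn_ge0 ?(ltW D0) ?(ltW q0').
have qM0 : 0 <= Num.sqrt q%:R * M by rewrite mulr_ge0 ?sqrtr_ge0.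
have [SM|SM] := leP S (q%:R * M ^+ 2).
  have : Num.sqrt S <= Num.sqrt q%:R * M.
    rewrite -[X in _ * X](ger0_norm M0) -sqrtr_sqr -sqrtrM ?ler0n //.
    by rewrite ler_sqrt // mulr_ge0 ?sqr_ge0 // ltW.
  have := sqrtr_ge0 A; lra.
have [SA|SA] := leP S A.
  have : Num.sqrt S <= Num.sqrt A by rewrite ler_sqrt // ltW.
  lra.
have Sp : 0 < S by exact: lt_trans SA.
have ySq l : 0 <= y l <= S / q%:R.
  have /andP[-> yl] := yM l.
  by rewrite /= (le_trans yl) // ler_pdivlMr // mulrC ltW.
have h := prod_ge_pow q0 th0 Sp ySq; rewrite -/S in h.
(* Since [S > A], the root of [S / A] is at most [S / A]; this puts the estimate in terms of the
   ratio that the product controls. *)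
have sAS : Num.sqrt S <= Num.sqrt A * (S / A).
  have sA : 0 < Num.sqrt A by rewrite sqrtr_gt0.
  have AE := sqr_sqrtr (ltW A0).
  have sS : 0 < Num.sqrt S by rewrite sqrtr_gt0.
  have SE := sqr_sqrtr (ltW Sp).
  have AS : Num.sqrt A <= Num.sqrt S by rewrite ler_sqrt ltW.
  rewrite mulrA ler_pdivlMr //; move: AE SE AS sA sS.
  move: (Num.sqrt A) (Num.sqrt S) => u v <- <- uv u0 v0.
  have : u * v * u <= u * v * v by rewrite ler_pM2l // mulr_gt0.
  have -> : v * u ^+ 2 = u * v * u by ring.
  by have -> : u * v ^+ 2 = u * v * v by ring.
suff : S / A <= q%:R ^+ q / D * \prod_l (1 + th * y l).
  move=> k; have : Num.sqrt A * (S / A) <=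
      Num.sqrt A * (q%:R ^+ q / D * \prod_l (1 + th * y l)).
    by rewrite ler_pM2l // sqrtr_gt0.
  have := sqrtr_ge0 A; lra.
apply: le_trans (_ : q%:R ^+ q / D * (1 + th * (S / q%:R)) ^+ q <= _);
  last first.
  by rewrite ler_pM2l // divr_gt0 // exprn_gt0.
apply: le_trans (_ : q%:R ^+ q / D * (th * (S / q%:R)) ^+ q <= _); last first.
  rewrite ler_pM2l ?divr_gt0 ?exprn_gt0 // lerXn2r ?nnegrE ?lerDr //;
    rewrite ?addr_ge0 // mulr_ge0 // divr_ge0 // ltW.
have -> : q%:R ^+ q / D * (th * (S / q%:R)) ^+ q =
    (S / A) ^+ q * ((th * A) ^+ q / D).
  rewrite !exprMn exprVn exprVn; field.
  by rewrite !expf_neq0 ?gt_eqF.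
(* As [S / A >= 1], its [q]-th power dominates its first power, while all [q] powers of [th * A]
   remain available to beat [D]. *)
have SA1 : 1 <= S / A by rewrite ler_pdivlMr // mul1r ltW.
apply: le_trans (_ : (S / A) ^+ q <= _); first by apply: ler_eXnr.
by rewrite ler_peMr ?exprn_ge0 ?(le_trans ler01) // ler_pdivlMr // mul1r.
Qed.

(** Twice the tangent bound for the logarithm, taken at the square root. It lets the logarithm of
    the number of fibers be absorbed by [sqrt N]. *)
Lemma ln_le_sqrt x : 0 < x -> ln x <= 2 * Num.sqrt x.
Proof.
move=> x0; have s0 : 0 < Num.sqrt x by rewrite sqrtr_gt0.
rewrite -{1}(sqr_sqrtr (ltW x0)) expr2 lnM ?posrE //.
have : ln (1 + (Num.sqrt x - 1)) <= Num.sqrt x - 1 by apply: le_ln1Dx; lra.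
rewrite addrC subrK; lra.
Qed.

End real_inequalities.

(** * Positions on a fiber and the number of multi-indices *)

Lemma set_coordK (r : nat) (n : 'I_r -> nat) (i : tindex n) (k : 'I_r) :
  set_coord i (i k) = i.
Proof.
apply/ffunP => j; rewrite ffunE.
have [<-|kj] := eqVneq k j; first by rewrite dfwithin.
by rewrite dfwithout.
Qed.

(** A fiber meets distinct positions of the tensor, so independence of the entries passes to it. *)
Lemma set_coord_inj (r : nat) (n : 'I_r -> nat) (i : tindex n) (k : 'I_r) :
  injective (@set_coord r n i k).
Proof.
move=> l1 l2 /ffunP /(_ k); rewrite !ffunE.
by rewrite !dfwithin.
Qed.

(** This counts the terms of the union bound, since the maximum over fibers is indexed by full
    multi-indices. *)
Lemma card_tindex_le (r : nat) (n : 'I_r -> nat) :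
  (#|tindex n| <= (\max_(k < r) n k) ^ r)%N.
Proof.
rewrite card_dep_ffun.
have -> : foldr muln 1%N [seq #|'I_(n x)| | x : 'I_r] = (\prod_(x < r) n x)%N.
  rewrite foldrE big_map big_enum /=.
  by apply: eq_bigr => x _; rewrite card_ord.
rewrite -[X in (_ ^ X)%N]card_ord -prod_nat_const.
by apply: leq_prod => x _; exact: leq_bigmax.
Qed.

(** * Measurability, and expectations of products along a fiber *)

Section expectations.
Context {R : realType} {d : measure_display} {T : measurableType d}.

Lemma measurable_bigmax (I : finType) (f : I -> T -> R) :
  (forall i, measurable_fun setT (f i)) ->
  measurable_fun setT (fun w => \big[Num.max/0]_i f i w).
Proof.
move=> mf; elim: (index_enum I) => [|i s IH].
  by under eq_fun do rewrite big_nil; exact: measurable_cst.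
by under eq_fun do rewrite big_cons; exact: measurable_maxr.
Qed.

Lemma measurable_sqrt : measurable_fun setT (@Num.sqrt R).
Proof. by apply: nondecreasing_measurable => // x y; exact: ler_wsqrtr. Qed.

Variable P : probability T R.

Lemma integral_prod_inj_indep (I J : finType) (X : I -> {RV P >-> R})
    (f : J -> I) (g : R -> R) (m : R) :
  mutually_independent X -> injective f ->
  measurable_fun setT g -> (forall x, 0 <= g x) ->
  (forall i, (\int[P]_w (g (X i w))%:E = m%:E)%E) ->
  (\int[P]_w (\prod_j g (X (f j) w))%:E = (m ^+ #|J|)%:E)%E.
Proof.
move=> indep finj mg g0 gm.
pose A : {set I} := [set f j | j : J]%SET.
(* Positions outside the image of [f] get the constant 1, of mean 1, so the product over all of [I]
   reduces to the one over [J]. *)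
pose h i := if i \in A then g else cst 1.
pose p i := if i \in A then m else 1.
have prodA (F : I -> R) : \prod_(i in A) F i = \prod_j F (f j).
  by rewrite big_imset //= => a b _ _; exact: finj.
have -> : m ^+ #|J| = \prod_i p i by rewrite -big_mkcond /= prodA prodr_const.
rewrite -(@integral_prod_indep _ _ _ P I X h p) //.
- apply: eq_integral => w _; congr (_%:E).
  rewrite -(prodA (fun i => g (X i w))) big_mkcond; apply: eq_bigr => i _.
  by rewrite /h; case: ifP.
- by move=> i; rewrite /h; case: ifP => // _; exact: measurable_cst.
- by move=> i x; rewrite /h; case: ifP.
- move=> i; rewrite /h /p; case: ifP => // _.
  by rewrite (integral_cst P measurableT 1%E) mul1e; exact: probability_setT.
Qed.

Context {d' : measure_display} {T' : measurableType d'}.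
Variable Q : probability T' R.

(** Both sides are the integral of [g] against the law of the variable, and the two laws agree on
    measurable sets. *)
Lemma integral_same_distribution (X : {RV P >-> R}) (Z : {RV Q >-> R})
    (g : R -> R) : same_distribution X Z ->
  measurable_fun setT g -> (forall x, 0 <= g x) ->
  (\int[P]_w (g (X w))%:E = \int[Q]_w (g (Z w))%:E)%E.
Proof.
move=> XZ mg g0.
have mg' : measurable_fun setT (EFin \o g) by exact/measurable_EFinP.
have g0' y : (0 <= (EFin \o g) y)%E by rewrite lee_fin.
rewrite -[LHS](ge0_integral_distribution X mg' g0').
rewrite -[RHS](ge0_integral_distribution Z mg' g0').
by apply: eq_measure_integral => B mB _; exact: XZ.
Qed.

Variables (r : nat) (n : 'I_r -> nat).
Variables (X : tindex n -> {RV P >-> R}) (Z : {RV Q >-> R}).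
Hypothesis iid : iid_copies X Z.

(** By independence the expectation is [(1 + t * e) ^+ n k], with [e] the mean of [f (Z w)]; then
    [1 + x <= expR x]. *)
Lemma integral_fiber_prod_le (N : nat) (i : tindex n) (k : 'I_r)
    (f : R -> R) (t mu : R) : (n k <= N)%N ->
  measurable_fun setT f -> (forall x, 0 <= f x) -> 0 <= t ->
  (\int[Q]_w (f (Z w))%:E <= mu%:E)%E ->
  (\int[P]_w (\prod_(l < n k) (1 + t * f (X (set_coord i l) w)))%:E
    <= (expR (N%:R * (t * mu)))%:E)%E.
Proof.
move=> nN mf f0 t0 fmu; have [indep sd] := iid.
have mfZ : measurable_fun setT (fun w => f (Z w)) by exact: measurableT_comp.
have fZ0 : (0 <= \int[Q]_w (f (Z w))%:E)%E.
  by apply: integral_ge0 => w _; rewrite lee_fin.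
have [e e0 eE] : exists2 e, 0 <= e & (\int[Q]_w (f (Z w))%:E = e%:E)%E.
  move: fZ0 fmu; case: (integral _ _ _) => [e||]//= e0 _.
  by exists e => //; rewrite -lee_fin.
rewrite eE lee_fin in fmu.
pose g x := 1 + t * f x.
have g0 x : 0 <= g x by rewrite /g addr_ge0 // mulr_ge0.
have mg : measurable_fun setT g.
  by apply: measurable_funD => //; apply: measurable_funM.
have gm j : (\int[P]_w (g (X j w))%:E = (1 + t * e)%:E)%E.
  rewrite (integral_same_distribution (sd j)) // /g.
  under eq_integral do rewrite EFinD EFinM.
  rewrite ge0_integralD //.
  - have -> : (\int[Q]_w 1%:E = 1)%E.
      rewrite (integral_cst Q measurableT 1%E) mul1e.
      exact: probability_setT.
    rewrite ge0_integralZl_EFin ?eE //.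
    + by move=> w _; rewrite lee_fin.
    + exact/measurable_EFinP.
  - by move=> w _; rewrite mule_ge0 // lee_fin.
  - by apply: measurable_funeM; exact/measurable_EFinP.
rewrite (@integral_prod_inj_indep _ _ X _ g (1 + t * e)) //; last first.
  exact: set_coord_inj.
rewrite card_ord lee_fin.
have te0 : 0 <= t * e by rewrite mulr_ge0.
apply: le_trans (_ : expR (t * e) ^+ n k <= _).
  by rewrite lerXn2r ?nnegrE ?expR_ge0 ?addr_ge0 // expR_ge1Dx.
rewrite -expRM_natl ler_expR.
apply: ler_pM => //; first by rewrite ler_nat.
by rewrite ler_wpM2l.
Qed.

End expectations.

(** * Splitting squares at a threshold *)

Definition trunc_sqr (R : realType) (be z : R) : R :=
  if `|z| <= be then z ^+ 2 else 0.

Definition tail_sqr (R : realType) (be z : R) : R :=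
  if `|z| <= be then 0 else z ^+ 2.

Section truncation.
Context {R : realType}.
Implicit Types (be z : R).

Lemma trunc_sqrD be z : trunc_sqr be z + tail_sqr be z = z ^+ 2.
Proof. by rewrite /trunc_sqr /tail_sqr; case: ifP; rewrite ?addr0 ?add0r. Qed.

Lemma trunc_sqr_ge0 be z : 0 <= trunc_sqr be z.
Proof. by rewrite /trunc_sqr; case: ifP => // _; exact: sqr_ge0. Qed.

Lemma tail_sqr_ge0 be z : 0 <= tail_sqr be z.
Proof. by rewrite /tail_sqr; case: ifP => // _; exact: sqr_ge0. Qed.

Lemma tail_sqr_le be z : tail_sqr be z <= z ^+ 2.
Proof. by rewrite -(trunc_sqrD be z) lerDr trunc_sqr_ge0. Qed.

Lemma trunc_sqr_le be z : trunc_sqr be z <= z ^+ 2.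
Proof. by rewrite -(trunc_sqrD be z) lerDl tail_sqr_ge0. Qed.

Lemma trunc_sqr_bound be z : trunc_sqr be z <= be ^+ 2.
Proof.
rewrite /trunc_sqr; case: ifP => [zb|_]; last exact: sqr_ge0.
rewrite -[z ^+ 2]real_normK ?num_real // lerXn2r ?nnegrE //.
exact: le_trans zb.
Qed.

Lemma measurable_trunc_sqr be : measurable_fun setT (trunc_sqr be).
Proof.
apply: measurable_fun_ifT => //.
by apply: measurable_fun_ler => //; exact: normr_measurable.
Qed.

Lemma measurable_tail_sqr be : measurable_fun setT (tail_sqr be).
Proof.
apply: measurable_fun_ifT => //.
by apply: measurable_fun_ler => //; exact: normr_measurable.
Qed.

(** Subadditivity of the square root separates the two parts of the split. The truncated squares are
    at most [be ^+ 2] and the tail squares at most [M ^+ 2], so [sqrt_sum_small_le] and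
    [sqrt_sum_big_le] apply with the same [A]. *)
Lemma sqrt_sum_sqr_le (m q : nat) (x : 'I_m -> R) (be th M A D a : R) :
  0 < be -> (0 < q)%N -> 0 <= th -> 0 < A -> 0 < D -> D <= (th * A) ^+ q ->
  (forall l, `|x l| <= M) ->
  0 <= M ->
  Num.sqrt (\sum_l x l ^+ 2) <= Num.sqrt q%:R * M + 2 * Num.sqrt A +
    2 * be ^+ 2 / Num.sqrt A *
      (a + expR (- a) * \prod_l (1 + be ^- 2 * trunc_sqr be (x l))) +
    Num.sqrt A * (q%:R ^+ q / D * \prod_l (1 + th * tail_sqr be (x l))).
Proof.
move=> be0 q0 th0 A0 D0 DA xM M0.
have sqrtD u v : 0 <= u -> 0 <= v ->
    Num.sqrt (u + v) <= Num.sqrt u + Num.sqrt v :> R.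
  move=> u0 v0; rewrite -[leRHS]ger0_norm ?addr_ge0 ?sqrtr_ge0 //.
  rewrite -sqrtr_sqr ler_wsqrtr // sqrrD !sqr_sqrtr // -addrA lerD2l lerDr.
  by rewrite mulrn_wge0 // mulr_ge0 ?sqrtr_ge0.
have -> : \sum_l x l ^+ 2 =
    \sum_l trunc_sqr be (x l) + \sum_l tail_sqr be (x l).
  by rewrite -big_split; apply: eq_bigr => l _; rewrite /= trunc_sqrD.
have h1 := @sqrt_sum_small_le _ _ (fun l => trunc_sqr be (x l)) (be ^+ 2) A a
  (exprn_gt0 2 be0) A0.
have h2 := @sqrt_sum_big_le _ _ _ (fun l => tail_sqr be (x l)) th M A D
  q0 th0 A0 D0 DA M0.
apply: le_trans (sqrtD _ _ _ _) _.
- by apply: sumr_ge0 => l _; exact: trunc_sqr_ge0.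
- by apply: sumr_ge0 => l _; exact: tail_sqr_ge0.
have /h1 {}h1 : forall l, 0 <= trunc_sqr be (x l) <= be ^+ 2.
  by move=> l; rewrite trunc_sqr_ge0 trunc_sqr_bound.
have /h2 {}h2 : forall l, 0 <= tail_sqr be (x l) <= M ^+ 2.
  move=> l; rewrite tail_sqr_ge0 (le_trans (tail_sqr_le _ _)) //.
  by rewrite -[_ ^+ 2]real_normK ?num_real // lerXn2r ?nnegrE.
under eq_bigr do rewrite mulrC.
move: h1 h2; lra.
Qed.

End truncation.

(** * Consequences of the moment bound of order [2 + eps] *)

Section moments.
Context {R : realType} {d : measure_display} {T : measurableType d}.
Variables (Q : probability T R) (Z : {RV Q >-> R}) (eps K : R).
Hypotheses (eps0 : 0 < eps) (K1 : 1 <= K).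

Let mZ : measurable_fun setT Z. Proof. exact: measurable_funP. Qed.

Let mZ2 : measurable_fun setT (fun w => Z w ^+ 2).
Proof. exact: measurable_funX. Qed.

Let mabsZ : measurable_fun setT (fun w => `|Z w|).
Proof. by apply: measurableT_comp => //; exact: normr_measurable. Qed.

Let mZp : measurable_fun setT (fun w => `|Z w| `^ (2 + eps)).
Proof. by apply: (measurableT_comp (measurable_powR _)). Qed.

Lemma integral_tail_sqr_le (be s : R) : 0 < be ->
  (\int[Q]_w (`|Z w| `^ (2 + eps))%:E <= (K * s `^ (2 + eps))%:E)%E ->
  (\int[Q]_w (tail_sqr be (Z w))%:E
    <= (be `^ (- eps) * (K * s `^ (2 + eps)))%:E)%E.
Proof.
move=> be0 h; rewrite EFinM.
apply: (@le_trans _ _ ((be `^ (- eps))%:E *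
  \int[Q]_w (`|Z w| `^ (2 + eps))%:E)%E); last first.
  by rewrite lee_wpmul2l // lee_fin powR_ge0.
rewrite -ge0_integralZl_EFin ?powR_ge0 //; last exact/measurable_EFinP.
apply: ge0_le_integral => //.
- by move=> w _; rewrite lee_fin tail_sqr_ge0.
- apply/measurable_EFinP; apply: measurableT_comp => //.
  exact: measurable_tail_sqr.
- by apply: measurable_funeM; exact/measurable_EFinP.
move=> w _; rewrite -EFinM lee_fin /tail_sqr; case: ifPn => [_|].
  by rewrite mulr_ge0 ?powR_ge0.
by rewrite -ltNge => /ltW zb; exact: sqr_le_powR (ltW eps0).
Qed.

(** Truncating at [M] gives [s ^+ 2 <= M * E|Z| + s ^+ 2 / 2], where the last term bounds the
    tail. *)
Lemma integral_norm_ge (s : R) : 0 <= s ->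
  (\int[Q]_w (Z w ^+ 2)%:E = (s ^+ 2)%:E)%E ->
  (\int[Q]_w (`|Z w| `^ (2 + eps))%:E <= (K * s `^ (2 + eps))%:E)%E ->
  ((s / (2 * (2 * K) `^ eps^-1))%:E <= \int[Q]_w (`|Z w|)%:E)%E.
Proof.
rewrite le_eqVlt => /predU1P[<-|s0] EZ2 EZp.
  by rewrite mul0r; apply: integral_ge0 => w _; rewrite lee_fin.
have K0 : 0 < 2 * K by rewrite mulr_gt0 // (lt_le_trans ltr01).
set L := (2 * K) `^ eps^-1.
have L0 : 0 < L by exact: powR_gt0.
(* Since [L] to the power [eps] is [2 * K], the tail beyond [M] carries at most half of the second
   moment. *)
pose M := L * s.
have M0 : 0 < M by rewrite mulr_gt0.
have tail := integral_tail_sqr_le M0 EZp.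
have tailE : M `^ (- eps) * (K * s `^ (2 + eps)) = s ^+ 2 / 2.
  rewrite powRN powRM ?ltW // -powRrM mulVf ?gt_eqF // powRr1 ?ltW //.
  rewrite powRD; last by rewrite (gt_eqF s0) implybT.
  rewrite (_ : s `^ 2 = s ^+ 2); last by rewrite -[2]/(2%:R) powR_mulrn ?ltW.
  have := powR_gt0 eps s0; set p := s `^ eps => p0.
  by field; rewrite !gt_eqF // (lt_le_trans ltr01).
rewrite tailE in tail.
have trunc : (\int[Q]_w (trunc_sqr M (Z w))%:E <=
              M%:E * \int[Q]_w (`|Z w|)%:E)%E.
  rewrite -ge0_integralZl_EFin ?(ltW M0) //; last exact/measurable_EFinP.
  apply: ge0_le_integral => //.
  - by move=> w _; rewrite lee_fin trunc_sqr_ge0.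
  - apply/measurable_EFinP; apply: measurableT_comp => //.
    exact: measurable_trunc_sqr.
  - by apply: measurable_funeM; exact/measurable_EFinP.
  move=> w _; rewrite -EFinM lee_fin /trunc_sqr; case: ifPn => [h|_].
    by rewrite -[_ ^+ 2]real_normK ?num_real // expr2 ler_wpM2r.
  by rewrite mulr_ge0 // ltW.
have split : ((s ^+ 2)%:E <=
    M%:E * \int[Q]_w (`|Z w|)%:E + (s ^+ 2 / 2)%:E)%E.
  rewrite -EZ2; under eq_integral do rewrite -(trunc_sqrD M) EFinD.
  rewrite ge0_integralD //; first exact: leeD.
  - by move=> w _; rewrite lee_fin trunc_sqr_ge0.
  - apply/measurable_EFinP; apply: measurableT_comp => //.
    exact: measurable_trunc_sqr.
  - by move=> w _; rewrite lee_fin tail_sqr_ge0.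
  - apply/measurable_EFinP; apply: measurableT_comp => //.
    exact: measurable_tail_sqr.
have : (0 <= \int[Q]_w (`|Z w|)%:E)%E.
  by apply: integral_ge0 => w _; rewrite lee_fin.
(* The first absolute moment is an extended real here; the value [+oo] satisfies the bound
   trivially. *)
move: split; case: (integral _ _ _) => [e||]; last 2 first.
- by move=> _ _; exact: leey.
- by move=> _; rewrite leNgt ltNy0.
rewrite -EFinM -EFinD !lee_fin /M => split _.
rewrite ler_pdivrMr ?mulr_gt0 //.
have : s * (s - 2 * L * e) <= 0 by lra.
rewrite pmulr_rle0 //; lra.
Qed.

End moments.

(** * Expected fiber maxima, from below and from above *)

(** The union bound in expectation: a maximum over fibers will be replaced by a sum, with [D]
    bounding the number of terms. *)
Lemma integral_sum_le {R : realType} {d : measure_display}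
    {T : measurableType d} (P : probability T R) (I : finType)
    (g : I -> T -> R) (c v D : R) :
  (forall i, measurable_fun setT (g i)) -> (forall i w, 0 <= g i w) ->
  0 <= c -> 0 <= v -> #|I|%:R <= D ->
  (forall i, (\int[P]_w (g i w)%:E <= v%:E)%E) ->
  (\int[P]_w (c * \sum_i g i w)%:E <= (c * (D * v))%:E)%E.
Proof.
move=> mg g0 c0 v0 ID gv.
have mgE i : measurable_fun setT (EFin \o g i) by exact/measurable_EFinP.
under eq_integral do rewrite EFinM -sumEFin.
rewrite ge0_integralZl_EFin //; first last.
- exact: emeasurable_sum.
- by move=> w _; apply: sume_ge0 => i _; rewrite lee_fin.
rewrite EFinM lee_wpmul2l // ge0_integral_sum //; last first.
  by move=> i w _; rewrite lee_fin.
apply: (@le_trans _ _ (\sum_(i : I) v%:E)%E); first exact: lee_sum.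
by rewrite sumEFin lee_fin sumr_const -mulr_natl ler_wpM2r.
Qed.

Section tensor.
Context {R : realType} {d : measure_display} {T : measurableType d}.
Variable P : probability T R.
Context {d' : measure_display} {T' : measurableType d'}.
Variable Q : probability T' R.
Variables (r : nat) (n : 'I_r -> nat).
Variables (X : tindex n -> {RV P >-> R}) (Z : {RV Q >-> R}).
Hypothesis iid : iid_copies X Z.

Let N := (\max_(k < r) n k)%N.

Lemma measurable_tensor_norm_infty :
  measurable_fun setT (fun w => tensor_norm_infty (fun i => X i w)).
Proof.
by apply: measurable_bigmax => i; exact: measurableT_comp.
Qed.

Lemma measurable_max_fiber_norm (k : 'I_r) :
  measurable_fun setT (fun w => max_fiber_norm (fun i => X i w) k).
Proof.
apply: measurable_bigmax => i; apply: (measurableT_comp measurable_sqrt).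
by apply: measurable_sum => l; exact: measurable_funX.
Qed.

Lemma tensor_norm_infty_ge0 (t : tindex n -> R) : 0 <= tensor_norm_infty t.
Proof. exact: bigmax_ge_id. Qed.

Lemma max_fiber_norm_ge0 (t : tindex n -> R) k : 0 <= max_fiber_norm t k.
Proof. exact: bigmax_ge_id. Qed.

(** Each entry lies on its own fiber in direction [k], where its square is one of the summands. *)
Lemma tensor_norm_infty_le_fiber (t : tindex n -> R) k :
  tensor_norm_infty t <= max_fiber_norm t k.
Proof.
apply: bigmax_le => [|i _]; first exact: max_fiber_norm_ge0.
apply: le_trans (le_bigmax _ _ i); rewrite -sqrtr_sqr ler_wsqrtr //.
rewrite (bigD1 (i k)) //= set_coordK lerDl.
by apply: sumr_ge0 => l _; exact: sqr_ge0.
Qed.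

Lemma integral_max_fiber_norm_ge (k : 'I_r) (m : R) : (forall j, 0 < n j)%N ->
  (m%:E <= \int[Q]_w (`|Z w|)%:E)%E ->
  ((m * Num.sqrt (n k)%:R)%:E <=
    \int[P]_w (max_fiber_norm (fun i => X i w) k)%:E)%E.
Proof.
move=> n0 mZ; have [_ sd] := iid.
(* One fixed fiber suffices for the lower bound; the one through the origin is taken. *)
pose i0 : tindex n := finfun (fun j => Ordinal (n0 j)).
have nk0 : 0 < (n k)%:R :> R by rewrite ltr0n.
have sn0 : 0 < Num.sqrt (n k)%:R :> R by rewrite sqrtr_gt0.
have mX i : measurable_fun setT (fun w => `|X i w|).
  by apply: measurableT_comp => //; exact: normr_measurable.
apply: (@le_trans _ _ (\int[P]_w ((Num.sqrt (n k)%:R)^-1 *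
    \sum_(l < n k) `|X (set_coord i0 l) w|)%:E)%E); last first.
  apply: ge0_le_integral => //.
  - move=> w _; rewrite lee_fin mulr_ge0 ?invr_ge0 ?sqrtr_ge0 //.
    by apply: sumr_ge0.
  - apply/measurable_EFinP; apply: measurable_funM => //.
    exact: measurable_sum.
  - apply/measurable_EFinP; exact: measurable_max_fiber_norm.
  move=> w _; rewrite lee_fin mulrC.
  apply: le_trans (sum_norm_le_sqrt _ (n0 k)) _.
  exact: (le_bigmax _
    (fun i => Num.sqrt (\sum_(l < n k) X (set_coord i l) w ^+ 2))).
under eq_integral do rewrite EFinM -sumEFin.
rewrite ge0_integralZl_EFin ?invr_ge0 ?sqrtr_ge0 //; first last.
- by apply: emeasurable_sum => l; exact/measurable_EFinP.
- by move=> w _; apply: sume_ge0 => l _; rewrite lee_fin.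
rewrite ge0_integral_sum //; last first.
  by move=> l; exact/measurable_EFinP.
apply: (@le_trans _ _ ((Num.sqrt (n k)%:R)^-1%:E * \sum_(l < n k) m%:E)%E).
  rewrite sumEFin -EFinM lee_fin sumr_const card_ord -[m *+ _]mulr_natr.
  rewrite -[X in _^-1 * (m * X)](sqr_sqrtr (ltW nk0)).
  set u := Num.sqrt _ in sn0 *.
  suff -> : u^-1 * (m * u ^+ 2) = m * u by [].
  by field; rewrite gt_eqF.
rewrite lee_wpmul2l ?lee_fin ?invr_ge0 ?sqrtr_ge0 //.
apply: lee_sum => l _; apply: (le_trans mZ).
by rewrite (integral_same_distribution (sd _) (@normr_measurable R setT)).
Qed.

(** Here [s] is any positive upper bound for the standard deviation that also satisfies the moment
    condition. The proof chooses the parameters of [sqrt_sum_sqr_le] and sums over all fibers. *)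
Lemma integral_max_fiber_norm_le (q : nat) (eps K s : R) (k : 'I_r) :
  0 < eps -> 1 <= K -> 0 < s -> (0 < q)%N -> (0 < N)%N ->
  r%:R <= eps / 4 * q%:R ->
  (\int[Q]_w (Z w ^+ 2)%:E <= (s ^+ 2)%:E)%E ->
  (\int[Q]_w (`|Z w| `^ (2 + eps))%:E <= (K * s `^ (2 + eps))%:E)%E ->
  (\int[P]_w (max_fiber_norm (fun i => X i w) k)%:E <=
   (Num.sqrt q%:R)%:E *
     \int[P]_w (tensor_norm_infty (fun i => X i w))%:E +
   (s * Num.sqrt N%:R * (6 + 4 * r%:R + q%:R ^+ q * expR K))%:E)%E.
Proof.
move=> eps0 K1 s0 q0 N0 rq EZ2 EZp.
have N1 : 1 <= N%:R :> R by rewrite ler1n.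
have nn0 : 0 < N%:R :> R by rewrite ltr0n.
set nn : R := N%:R in N1 nn0 *.
pose u := Num.sqrt nn.
have u0 : 0 < u by rewrite sqrtr_gt0.
have uE : u ^+ 2 = nn by rewrite sqr_sqrtr // ltW.
have u1 : 1 <= u by rewrite -[1]sqrtr1 ler_wsqrtr.
(* Chosen so that [sqrt A] is the target scale [s * sqrt N]. *)
pose A := s ^+ 2 * nn.
have A0 : 0 < A by rewrite mulr_gt0 ?exprn_gt0.
have sA : Num.sqrt A = s * u.
  by rewrite sqrtrM ?sqr_ge0 // sqrtr_sqr gtr0_norm.
(* At this threshold [be ^+ 2 / sqrt A = s], so [a] may be of order [sqrt N]; and
   [N * s ^+ 2 / be ^+ 2 = u] bounds the exponent in the truncated part. *)
pose be := s * nn `^ (4^-1).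
have be0 : 0 < be by rewrite mulr_gt0 ?powR_gt0.
have beE : be ^+ 2 = s ^+ 2 * u.
  rewrite exprMn; congr (_ * _); rewrite -powR_mulrn ?powR_ge0 // -powRrM.
  by rewrite (_ : 4^-1 * 2%:R = 2^-1) ?powR12_sqrt ?ltW //; field.
(* This is [be / s] to the power [eps], the gain of the tail moment: a tail square has mean at most
   [K * s ^+ 2 / v]. With [th = v / A] the exponent of the tail product is then exactly [K]. *)
pose v := nn `^ (eps / 4).
have v0 : 0 < v by exact: powR_gt0.
pose th := v / A.
have th0 : 0 <= th by rewrite divr_ge0 ?ltW.
pose D := nn ^+ r.
have D0 : 0 < D by rewrite exprn_gt0.
(* As [th * A = v], this is where [q >= 4 * r / eps] enters. *)
have DA : D <= (th * A) ^+ q.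
  rewrite /th divfK ?gt_eqF // -powR_mulrn ?(ltW v0) // -powRrM /D.
  by rewrite -powR_mulrn ?(ltW nn0) // ler_powR.
(* Chosen so that [expR (- a)] cancels both [expR u], the mean of a truncated product, and [D], the
   count of fibers. *)
pose a := u + r%:R * ln nn.
have lnn : ln nn <= 2 * u by exact: ln_le_sqrt.
have lnn0 : 0 <= ln nn by exact: ln_ge0.
have r0 : 0 <= r%:R :> R by rewrite ler0n.
have a0 : 0 <= a by rewrite addr_ge0 ?mulr_ge0 // ltW.
pose P1 (i : tindex n) w :=
  \prod_(l < n k) (1 + be ^- 2 * trunc_sqr be (X (set_coord i l) w)).
pose P2 (i : tindex n) w :=
  \prod_(l < n k) (1 + th * tail_sqr be (X (set_coord i l) w)).
have P10 i w : 0 <= P1 i w.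
  apply: prodr_ge0 => l _; rewrite addr_ge0 // mulr_ge0 ?trunc_sqr_ge0 //.
  by rewrite invr_ge0 sqr_ge0.
have P20 i w : 0 <= P2 i w.
  by apply: prodr_ge0 => l _; rewrite addr_ge0 // mulr_ge0 ?tail_sqr_ge0.
have mP1 i : measurable_fun setT (P1 i).
  apply: measurable_prod => l _; apply: measurable_funD => //.
  apply: measurable_funM => //.
  by apply: measurableT_comp => //; exact: measurable_trunc_sqr.
have mP2 i : measurable_fun setT (P2 i).
  apply: measurable_prod => l _; apply: measurable_funD => //.
  apply: measurable_funM => //.
  by apply: measurableT_comp => //; exact: measurable_tail_sqr.
have nkN : (n k <= N)%N by exact: leq_bigmax.
have E1 i : (\int[P]_w (P1 i w)%:E <= (expR u)%:E)%E.
  have <- : nn * (be ^- 2 * s ^+ 2) = u.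
    by rewrite beE -uE; field; rewrite !gt_eqF.
  apply: (integral_fiber_prod_le iid) => //.
  - exact: measurable_trunc_sqr.
  - exact: trunc_sqr_ge0.
  - by rewrite invr_ge0 sqr_ge0.
  apply: le_trans EZ2; apply: ge0_le_integral => //.
  - by move=> w _; rewrite lee_fin trunc_sqr_ge0.
  - apply/measurable_EFinP; apply: measurableT_comp => //.
    exact: measurable_trunc_sqr.
  - by apply/measurable_EFinP; exact: measurable_funX.
  - by move=> w _; rewrite lee_fin trunc_sqr_le.
have E2 i : (\int[P]_w (P2 i w)%:E <= (expR K)%:E)%E.
  have KE : nn * (th * (be `^ (- eps) * (K * s `^ (2 + eps)))) = K.
    rewrite powRN powRM ?powR_ge0 ?(ltW s0) // -powRrM [4^-1 * _]mulrC -/v.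
    rewrite powRD; last by rewrite (gt_eqF s0) implybT.
    rewrite (_ : s `^ 2 = s ^+ 2); last by rewrite -[2]/(2%:R) powR_mulrn ?ltW.
    have := powR_gt0 eps s0; set p := s `^ eps => p0.
    by rewrite /th /A; field; rewrite !gt_eqF.
  rewrite -[X in expR X]KE; apply: (integral_fiber_prod_le iid) => //.
  - exact: measurable_tail_sqr.
  - exact: tail_sqr_ge0.
  - exact: integral_tail_sqr_le.
have cardD : #|tindex n|%:R <= D.
  by rewrite /D /nn -natrX ler_nat; exact: card_tindex_le.
pose M w := tensor_norm_infty (fun i => X i w).
have mM : measurable_fun setT M by exact: measurable_tensor_norm_infty.
have M0 w : 0 <= M w by exact: tensor_norm_infty_ge0.
pose c0 := 2 * (s * u) + 2 * s * a.
pose c1 := 2 * s * expR (- a).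
pose c2 := s * u * (q%:R ^+ q / D).
have c00 : 0 <= c0.
  by rewrite addr_ge0 // !mulr_ge0 // ?(ltW s0) ?(ltW u0).
have c10 : 0 <= c1 by rewrite !mulr_ge0 ?expR_ge0 ?(ltW s0).
have c20 : 0 <= c2.
  by rewrite !mulr_ge0 ?exprn_ge0 ?invr_ge0 ?(ltW s0) ?(ltW u0) ?(ltW D0).
have pointwise w : max_fiber_norm (fun i => X i w) k <=
    Num.sqrt q%:R * M w +
      (c0 + (c1 * (\sum_i P1 i w) + c2 * (\sum_i P2 i w))).
  have S10 : 0 <= \sum_i P1 i w by apply: sumr_ge0.
  have S20 : 0 <= \sum_i P2 i w by apply: sumr_ge0.
  (* The maximum has default value 0, so the right-hand side must also be shown nonnegative. *)
  apply: bigmax_le => [|i _].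
    apply: addr_ge0; first by rewrite mulr_ge0 ?sqrtr_ge0.
    by apply: addr_ge0 => //; apply: addr_ge0; exact: mulr_ge0.
  have xM (l : 'I_(n k)) : `|X (set_coord i l) w| <= M w.
    exact: (le_bigmax _ (fun j => `|X j w|)).
  have := @sqrt_sum_sqr_le _ _ _ (fun l => X (set_coord i l) w) _ _ _ _ _ a
    be0 q0 th0 A0 D0 DA xM (M0 w).
  rewrite -/(P1 i w) -/(P2 i w) sA beE.
  have -> : 2 * (s ^+ 2 * u) / (s * u) = 2 * s by field; rewrite !gt_eqF.
  have : c1 * P1 i w <= c1 * \sum_i P1 i w.
    rewrite ler_wpM2l // (bigD1 i) //= lerDl; exact: sumr_ge0.
  have : c2 * P2 i w <= c2 * \sum_i P2 i w.
    rewrite ler_wpM2l // (bigD1 i) //= lerDl; exact: sumr_ge0.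
  rewrite /c0 /c1 /c2.
  set e := expR (- a); set g := _ / D; set p1 := P1 i w; set p2 := P2 i w.
  move=> h2 h1 h; apply: (le_trans h); lra.
pose S1 w := c1 * \sum_i P1 i w.
pose S2 w := c2 * \sum_i P2 i w.
have mS1 : measurable_fun setT (EFin \o S1).
  apply/measurable_EFinP; apply: measurable_funM => //.
  exact: measurable_sum.
have mS2 : measurable_fun setT (EFin \o S2).
  apply/measurable_EFinP; apply: measurable_funM => //.
  exact: measurable_sum.
have S10 w : (0 <= (S1 w)%:E)%E by rewrite lee_fin mulr_ge0 // sumr_ge0.
have S20 w : (0 <= (S2 w)%:E)%E by rewrite lee_fin mulr_ge0 // sumr_ge0.
have mqM : measurable_fun setT (fun w => (Num.sqrt q%:R)%:E * (M w)%:E)%E.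
  by apply: measurable_funeM; exact/measurable_EFinP.
have mS : measurable_fun setT (fun w => (S1 w)%:E + (S2 w)%:E)%E.
  exact: emeasurable_funD.
have mcS : measurable_fun setT (fun w => c0%:E + ((S1 w)%:E + (S2 w)%:E))%E.
  exact: emeasurable_funD.
apply: (@le_trans _ _ (\int[P]_w ((Num.sqrt q%:R)%:E * (M w)%:E +
    (c0%:E + ((S1 w)%:E + (S2 w)%:E))))%E).
  apply: ge0_le_integral => //.
  - by move=> w _; rewrite lee_fin max_fiber_norm_ge0.
  - apply/measurable_EFinP; exact: measurable_max_fiber_norm.
  - exact: emeasurable_funD.
  - by move=> w _; rewrite -EFinM -!EFinD lee_fin.
have sq0 : 0 <= Num.sqrt q%:R :> R by exact: sqrtr_ge0.
have intc0 : (\int[P]_w c0%:E = c0%:E)%E.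
  rewrite (integral_cst P measurableT c0%:E) -[RHS]mule1; congr (_ * _)%E.
  exact: probability_setT.
have -> : (\int[P]_w ((Num.sqrt q%:R)%:E * (M w)%:E +
    (c0%:E + ((S1 w)%:E + (S2 w)%:E))) =
  (Num.sqrt q%:R)%:E * \int[P]_w (M w)%:E +
    (c0%:E + (\int[P]_w (S1 w)%:E + \int[P]_w (S2 w)%:E)))%E.
  rewrite ge0_integralD //; first last.
  - by move=> w _; rewrite !adde_ge0 // lee_fin.
  - by move=> w _; rewrite mule_ge0 // lee_fin.
  congr (_ + _)%E.
    rewrite ge0_integralZl_EFin //; first by move=> w _; rewrite lee_fin.
    exact/measurable_EFinP.
  rewrite ge0_integralD //; last by move=> w _; rewrite adde_ge0.
  by rewrite intc0 ge0_integralD.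
rewrite leeD2l //.
have I1 : (\int[P]_w (S1 w)%:E <= (c1 * (D * expR u))%:E)%E.
  by apply: integral_sum_le => //; exact: expR_ge0.
have I2 : (\int[P]_w (S2 w)%:E <= (c2 * (D * expR K))%:E)%E.
  by apply: integral_sum_le => //; exact: expR_ge0.
apply: (@le_trans _ _ (c0%:E +
    ((c1 * (D * expR u))%:E + (c2 * (D * expR K))%:E))%E).
  by rewrite leeD2l // leeD.
rewrite -!EFinD lee_fin.
have -> : c1 * (D * expR u) = 2 * s.
  have -> : D = expR (r%:R * ln nn) by rewrite expRM_natl lnK.
  by rewrite -expRD /c1 -mulrA -expRD [r%:R * _ + u]addrC -/a addNr expR0 mulr1.
have -> : c2 * (D * expR K) = s * u * (q%:R ^+ q * expR K).
  by rewrite /c2; field; rewrite gt_eqF.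
(* In units of [s * u]: [c0] costs at most [4 + 4 * r], the truncated products 2 because [1 <= u],
   and the tail products [q ^+ q * expR K]. *)
have h1 : s * (r%:R * ln nn) <= s * (r%:R * (2 * u)).
  by rewrite ler_pM2l // ler_wpM2l.
have h2 : s * 1 <= s * u by rewrite ler_pM2l.
rewrite /c0 /a -/u; set g := q%:R ^+ q * expR K; lra.
Qed.

End tensor.

(** * The two-sided estimate with explicit constants *)

Theorem propositionB1 (R : realType) (r : nat) (eps K : R)
    (hr : (2 <= r)%N) (heps : 0 < eps < 1) (hK : 1 <= K) :
  exists c C : R, 0 < c /\ 0 < C /\
    forall (n : 'I_r -> nat) (hn : forall k, (2 <= n k)%N)
      (d : measure_display) (Omega : measurableType d)
      (P : probability Omega R)
      (d' : measure_display) (Omega' : measurableType d')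
      (Q : probability Omega' R)
      (Z : {RV Q >-> R}) (T : tindex n -> {RV P >-> R}),
      iid_copies T Z ->
      'E_Q[Z]%E = 0%E ->
      ('E_Q[fun w => (Z w ^+ 2)%R] < +oo)%E ->
      let sigma : R := Num.sqrt (fine 'E_Q[fun w => (Z w ^+ 2)%R]%E) in
      ('E_Q[fun w => (`|Z w| `^ (2 + eps))%R]
         <= (K * sigma `^ (2 + eps))%:E)%E ->
      let N : nat := (\max_(k < r) n k)%N in
      let S : \bar R :=
        ((sigma * Num.sqrt N%:R)%:E
          + 'E_P[fun w => tensor_norm_infty (fun i => T i w)])%E in
      (c%:E * S <= tensor_R T)%E /\ (tensor_R T <= C%:E * S)%E.
Proof.
have /andP[eps0 _] := heps.
have K0 : 0 < 2 * K by rewrite mulr_gt0 // (lt_le_trans ltr01).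
pose L := (2 * K) `^ eps^-1.
have L1 : 1 <= L.
  rewrite -(powRr0 (2 * K)); apply: ler_powR; last by rewrite invr_ge0 ltW.
  by lra.
have L0 : 0 < L by exact: lt_le_trans L1.
have [q q0 rq] : exists2 q, (0 < q)%N & r%:R <= eps / 4 * q%:R.
  have e40 : 0 < eps / 4 by rewrite divr_gt0.
  exists (Num.bound (r%:R / (eps / 4))).+1 => //.
  rewrite mulrC -ler_pdivrMr // (le_trans (ltW (archi_boundP _))) //.
    by rewrite divr_ge0 // ltW.
  by rewrite ler_nat.
pose B := 6 + 4 * r%:R + q%:R ^+ q * expR K.
have B0 : 0 < B.
  by rewrite ltr_pwDl ?mulr_ge0 ?exprn_ge0 ?expR_ge0 // ltr_pwDl ?mulr_ge0.
(* Below, [sigma * u] costs [2 * L] and the entry maximum at most [L], within [4 * L]. Above, the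
   two coefficients [sqrt q] and [B] are added to serve both terms. *)
exists (4 * L)^-1, (Num.sqrt q%:R + B).
split; first by rewrite invr_gt0 mulr_gt0.
split; first by rewrite ltr_wpDl ?sqrtr_ge0.
move=> n hn d Omega P d' Omega' Q Z T iid _.
rewrite /tensor_R unlock => EZ2.
set sigma := Num.sqrt (fine _) => EZp; set N := (\max_(k < r) n k)%N.
set E := (\int[P]_w (tensor_norm_infty (fun i => T i w))%:E)%E.
pose F k := (\int[P]_w (max_fiber_norm (fun i => T i w) k)%:E)%E.
rewrite -/F.
have n0 j : (0 < n j)%N by exact: leq_trans (hn j).
pose k0 : 'I_r := Ordinal (ltnW hr).
have N0 : (0 < N)%N by exact: leq_trans (n0 k0) (leq_bigmax k0).
have u0 : 0 < Num.sqrt N%:R :> R by rewrite sqrtr_gt0 ltr0n.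
set u := Num.sqrt N%:R in u0 *.
have sigma0 : 0 <= sigma by exact: sqrtr_ge0.
have E0 : (0 <= E)%E.
  by apply: integral_ge0 => w _; rewrite lee_fin tensor_norm_infty_ge0.
have EZ2E : (\int[Q]_w (Z w ^+ 2)%:E = (sigma ^+ 2)%:E)%E.
  have Z20 : (0 <= \int[Q]_w (Z w ^+ 2)%:E)%E.
    by apply: integral_ge0 => w _; rewrite lee_fin sqr_ge0.
  by rewrite /sigma sqr_sqrtr ?fine_ge0 // fineK // ge0_fin_numE.
split.
  set W := (\big[maxe/-oo]_(k < r) _)%E.
  have WE : (E <= W)%E.
    apply: le_trans (le_bigmax _ F k0); apply: ge0_le_integral => //.
    - by move=> w _; rewrite lee_fin tensor_norm_infty_ge0.
    - apply/measurable_EFinP; exact: measurable_tensor_norm_infty.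
    - apply/measurable_EFinP; exact: measurable_max_fiber_norm.
    - by move=> w _; rewrite lee_fin tensor_norm_infty_le_fiber.
  have Ws : ((sigma / (2 * L) * u)%:E <= W)%E.
    have r0 : (0 < #|'I_r|)%N by rewrite card_ord ltnW.
    (* Fibers in a longest direction give the full [sqrt N]. *)
    have [k kN] := bigop.eq_bigmax n r0.
    apply: le_trans (le_bigmax _ F k).
    have -> : u = Num.sqrt (n k)%:R by rewrite /u /N kN.
    apply: (integral_max_fiber_norm_ge iid) => //.
    exact: integral_norm_ge.
  (* Infinite expectations are allowed: [E = +oo] forces [W = +oo]. *)
  move: E0 WE Ws; case: E W => [e||] [x||] //; rewrite ?leey //.
  rewrite -EFinD -EFinM !lee_fin.
  move=> e0 ex sx; rewrite ler_pdivrMl ?mulr_gt0 //.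
  have : sigma * u <= 2 * L * x.
    by move: sx; rewrite mulrAC ler_pdivrMr ?mulr_gt0 // [x * _]mulrC.
  have : e <= L * x by rewrite (le_trans ex) // ler_peMl // (le_trans e0).
  have : 0 <= L * x by rewrite mulr_ge0 ?(ltW L0) // (le_trans e0).
  lra.
apply: bigmax_le => [|k _]; first exact: leNye.
apply: (@le_trans _ _ ((Num.sqrt q%:R)%:E * E + (sigma * u * B)%:E)%E).
  (* Working with s > sigma also covers the degenerate case sigma = 0. *)
  apply/lee_addgt0Pr => e e0.
  (* The increment is scaled so that the bound grows by exactly [e]. *)
  pose s := sigma + e / (u * B).
  have uB : 0 < u * B by rewrite mulr_gt0.
  have ss : sigma < s by rewrite ltrDl divr_gt0.
  have s0 : 0 < s by exact: le_lt_trans ss.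
  have -> : ((Num.sqrt q%:R)%:E * E + (sigma * u * B)%:E + e%:E =
      (Num.sqrt q%:R)%:E * E + (s * u * B)%:E)%E.
    rewrite -addeA -EFinD; congr (_ + _%:E)%E.
    by rewrite /s; field; rewrite !gt_eqF.
  apply: (integral_max_fiber_norm_le iid k eps0 hK s0 q0 N0 rq).
    by rewrite EZ2E lee_fin lerXn2r ?nnegrE // ltW.
  apply: (le_trans EZp); rewrite lee_fin ler_wpM2l ?(le_trans ler01) //.
  have e20 : 0 <= 2 + eps by rewrite addr_ge0 // ltW.
  by apply: (ge0_ler_powR e20); rewrite ?nnegrE // ltW.
have su0 : (0 <= (sigma * u)%:E)%E by rewrite lee_fin mulr_ge0 // ltW.
rewrite (ge0_muleDr _ su0 E0) addeC leeD //.
  rewrite -EFinM lee_fin mulrC ler_wpM2r ?mulr_ge0 ?(ltW u0) //.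
  by rewrite lerDr sqrtr_ge0.
by rewrite lee_wpmul2r // lee_fin lerDl ltW.
Qed.
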